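(* Assume that for some $\beta>0$ $$p^\beta,\ q^\beta,\ \ln p\in\mathbb L_1(Q)\quad\text{for all }P\in\mathcal P,\ Q\in\mathcal P^+,$$ where $p,q$ are the densities of $P,Q$ with respect to $\lambda$. Then, for all $0<\alpha<\beta$, $$\mathfrak R_\alpha(P,Q)=\frac1{1+\alpha}\ln(P\cdot p^\alpha)+\frac1{\alpha(1+\alpha)}\ln(Q\cdot q^\alpha)-\frac1\alpha\ln(Q\cdot p^\alpha),\qquad P\in\mathcal P,\ Q\in\mathcal P^+,$$ is a family of pseudodistances, decomposable in the sense $$\mathfrak R_\alpha(P,Q)=\mathfrak R_\alpha^0(P)+\mathfrak R_\alpha^1(Q)-\frac1\alpha\ln(Q\cdot p^\alpha)$$ for $\mathfrak R_\alpha^0(P)=\frac1{1+\alpha}\ln(P\cdot p^\alpha)$ and $\mathfrak R_\alpha^1(Q)=\frac1{\alpha(1+\alpha)}\ln(Q\cdot q^\alpha)$, and satisfying the limit relation $$\mathfrak R_\alpha(P,Q)\to\mathfrak R_0(P,Q):=Q\cdot\ln q-Q\cdot\ln p\quad\text{for }\alpha\downarrow0 .$$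
   Context: $\mathcal P=\{P_\theta:\theta\in\Theta\}$, $\Theta\subset\mathbb R^d$, is an identifiable ($P_\theta\neq P_{\tilde\theta}$ for $\theta\ne\tilde\theta$) family of mutually equivalent probability measures on a measurable space $(\mathcal X,\mathcal A)$ dominated by a $\sigma$-finite measure $\lambda$; $P_0\notin\mathcal P$ is a probability measure equivalent with the members of $\mathcal P$; $\mathcal P^+=\mathcal P\cup\{P_0\}$. All densities with respect to $\lambda$ are $>0$ $\lambda$-a.s. $\mathbb L_1(Q)$ is the set of absolutely $Q$-integrable functions and $Q\cdot f=\int f\,\mathrm dQ$. A pseudodistance is a map $\mathfrak D:\mathcal P\otimes\mathcal P^+\to\mathbb R$ with $\mathfrak D(P_\theta,P_{\tilde\theta})\ge0$ for all $\theta,\tilde\theta\in\Theta$ and $\mathfrak D(P_\theta,P_{\tilde\theta})=0$ iff $\theta=\tilde\theta$. *)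

(* Defs.v *)
From HB Require Import structures.
From mathcomp Require Import all_boot all_order all_algebra.
From mathcomp Require Import all_classical all_reals all_analysis.
Set Implicit Arguments.
Unset Strict Implicit.
Unset Printing Implicit Defensive.
Import Order.TTheory GRing.Theory Num.Theory.
Import numFieldNormedType.Exports.
Local Open Scope classical_set_scope.
Local Open Scope ring_scope.

Section pseudodistances.
Context {disp : measure_display} {X : measurableType disp} {R : realType}.

(* Measures of the library are total on [set X], with constraints on measurable
   sets only, so Leibniz equality of measures is too fine a notion. *)
Definition same_probability (P Q : probability X R) : Prop :=
  forall A : set X, measurable A -> P A = Q A.

Definition is_density (lambda : {measure set X -> \bar R})
    (Q : probability X R) (q : X -> R) : Prop :=
  [/\ measurable_fun setT q, (forall x, 0 <= q x) &
      forall A, measurable A -> Q A = (\int[lambda]_(x in A) (q x)%:E)%E].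

Definition L1 (Q : probability X R) (f : X -> R) : Prop :=
  Q.-integrable setT (EFin \o f).

(* Finite on [L1 Q]; the value is meaningless outside of it. *)
Definition expect (Q : probability X R) (f : X -> R) : R :=
  \int[Q]_(x in setT) f x.

Definition pseudodistance (k : nat) (Theta : set 'rV[R]_k)
    (P_ : 'rV[R]_k -> probability X R)
    (D : probability X R -> probability X R -> R) : Prop :=
  forall theta theta', Theta theta -> Theta theta' ->
    0 <= D (P_ theta) (P_ theta') /\
    (D (P_ theta) (P_ theta') = 0 <-> theta = theta').

(* In what follows [dens Q] is a chosen version of the density of [Q] with
   respect to the dominating measure. *)
Variable dens : probability X R -> X -> R.

Definition renyi_const (alpha : R) (P : probability X R) : R :=
  (1 + alpha)^-1 * ln (expect P (fun x => dens P x `^ alpha)).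

Definition renyi_self (alpha : R) (Q : probability X R) : R :=
  (alpha * (1 + alpha))^-1 * ln (expect Q (fun x => dens Q x `^ alpha)).

Definition renyi (alpha : R) (P Q : probability X R) : R :=
  (1 + alpha)^-1 * ln (expect P (fun x => dens P x `^ alpha))
  + (alpha * (1 + alpha))^-1 * ln (expect Q (fun x => dens Q x `^ alpha))
  - alpha^-1 * ln (expect Q (fun x => dens P x `^ alpha)).

Definition renyi0 (P Q : probability X R) : R :=
  expect Q (fun x => ln (dens Q x)) - expect Q (fun x => ln (dens P x)).

(* [expect] and [ln] are total with default values. This says that all the
   expectations in [renyi alpha P Q] are finite, and that those to which [ln] is
   applied are positive, so that no default value is involved. *)
Definition renyi_defined (alpha : R) (P Q : probability X R) : Prop :=
  [/\ L1 P (fun x => dens P x `^ alpha)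
        /\ 0 < expect P (fun x => dens P x `^ alpha),
      L1 Q (fun x => dens Q x `^ alpha)
        /\ 0 < expect Q (fun x => dens Q x `^ alpha) &
      L1 Q (fun x => dens P x `^ alpha)
        /\ 0 < expect Q (fun x => dens P x `^ alpha)].

Definition renyi0_defined (P Q : probability X R) : Prop :=
  L1 Q (fun x => ln (dens Q x)) /\ L1 Q (fun x => ln (dens P x)).

End pseudodistances.

(* Main.v *)
Require Import Defs.
From HB Require Import structures.
From mathcomp Require Import all_boot all_order all_algebra.
From mathcomp Require Import all_classical all_reals all_analysis.
From mathcomp Require Import measurable_realfun.
From mathcomp Require Import ring lra.
Import Order.TTheory GRing.Theory Num.Theory.
Import numFieldNormedType.Exports.
Local Open Scope classical_set_scope.
Local Open Scope ring_scope.

(** Densities are handled through their logarithms: [p] is a.e. equal to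
    [expR (ln p)], which turns every power of [p] into the exponential of a
    multiple of [ln p] and reduces all the estimates to the convexity of [expR].

    The inequality. Let [A = P.p^a], [B = Q.q^a], [M = Q.p^a]. Rewritten as
    integrals for the dominating measure, [A], [B] and [M] are the integrals of
    [p^(1+a)], [q^(1+a)] and [p^a q]. With [t = a / (1+a)], the functions
    [u = (1+a) ln p - ln A] and [v = (1+a) ln q - ln B] satisfy
    [int e^u = int e^v = 1], and [e^(t u + (1-t) v) = p^a q / (A^t B^(1-t))].
    Convexity of [expR] gives [M <= A^t B^(1-t)] ([Rintegral_expR_convex], which
    is Hoelder's inequality), that is, [a R_a(P,Q) >= 0]. By strict convexity,
    equality forces [u = v] a.e., so [p] and [q] are proportional; both have
    total mass 1, so [p = q] a.e. and [P = Q] ([renyi_gap]). Identifiability then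
    gives equality of the parameters.

    The limit. If [g] and [e^(b g)] are integrable, then [a^-1 ln E e^(a g)] tends
    to [E g] as [a] decreases to 0 ([ln_expect_expR_cvg]): it is at least [E g] by
    Jensen's inequality, and at most [E ((e^(a g) - 1) / a)] because
    [ln x <= x - 1]; the latter tends to [E g] by dominated convergence, since the
    difference quotients of the exponential increase with [a]. For [g = ln q] and
    [g = ln p] under [Q] this is the limit of the last two terms of
    [R_a(P,Q)]; the first term is [a / (1+a)] times a convergent quantity.

    For the limit to be meaningful, [ln q] must be [Q]-integrable also when [Q] is
    outside the model ([L1_ln_density]). Its positive part is bounded by
    [q^b / b]; its negative part by [|ln p| + p / q], where [p / q] has
    [Q]-integral at most 1. *)

(** * The exponential function *)

Section expR_facts.
Context {R : realType}.
Implicit Types t a b y m : R.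

Lemma expR_tangent m y : expR m * (1 + (y - m)) <= expR y.
Proof.
rewrite -{2}(subrK m y) (addrC (y - m) m) expRD.
by rewrite ler_pM2l ?expR_gt0// expR_ge1Dx.
Qed.

Lemma expR_tangent_eq m y : expR y <= expR m * (1 + (y - m)) -> y = m.
Proof.
rewrite -{1}(subrK m y) (addrC (y - m) m) expRD ler_pM2l ?expR_gt0// => h.
apply/eqP; rewrite -subr_eq0; apply: contraTT h => h.
by rewrite -ltNge expR_gt1Dx.
Qed.

Lemma expR_convex t a b : 0 <= t -> t <= 1 ->
  expR (t * a + (1 - t) * b) <= t * expR a + (1 - t) * expR b.
Proof. by move=> t0 t1; exact: (convex_expR (Itv01 t0 t1) a b). Qed.

(** The tangent at the barycentre [m] of [a] and [b] lies below the graph, and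
    averaging it over [a] and [b] gives back [expR m]: in the equality case it
    meets the graph at [a] and at [b], hence [a = m = b]. *)
Lemma expR_convex_eq t a b : 0 < t -> t < 1 ->
  expR (t * a + (1 - t) * b) = t * expR a + (1 - t) * expR b -> a = b.
Proof.
move=> t0 t1; set m := t * a + _ => e.
have t1' : 0 < 1 - t by rewrite subr_gt0.
have em : expR m = t * (expR m * (1 + (a - m)))
  + (1 - t) * (expR m * (1 + (b - m))) by rewrite /m; ring.
have ha := ler_wpM2l (ltW t0) (expR_tangent m a).
have hb := ler_wpM2l (ltW t1') (expR_tangent m b).
have -> : a = m by apply: expR_tangent_eq; rewrite -(ler_pM2l t0); lra.
by have -> // : b = m by apply: expR_tangent_eq; rewrite -(ler_pM2l t1'); lra.
Qed.

Lemma expR_slope_ge a y : 0 < a -> y <= (expR (a * y) - 1) / a.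
Proof. by move=> a0; rewrite ler_pdivlMr// mulrC lerBrDl expR_ge1Dx. Qed.

Lemma expR_slope_le a y : 0 < a -> (expR (a * y) - 1) / a <= y * expR (a * y).
Proof.
move=> a0; rewrite ler_pdivrMr//.
(* the tangent at [a * y], evaluated at 0 *)
have := expR_tangent (a * y) 0; rewrite expR0; nra.
Qed.

Lemma expR_slope_homo a b y : 0 < a -> a <= b ->
  (expR (a * y) - 1) / a <= (expR (b * y) - 1) / b.
Proof.
move=> a0 ab; have b0 := lt_le_trans a0 ab.
have t1 : a / b <= 1 by rewrite ler_pdivrMr// mul1r.
(* [a * y] is the barycentre of [b * y] and 0 with weight [a / b] *)
have := @expR_convex (a / b) (b * y) 0 (divr_ge0 (ltW a0) (ltW b0)) t1.
rewrite mulr0 addr0 expR0 mulrA divfK ?gt_eqF// => h.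
rewrite ler_pdivrMr//.
have -> : (expR (b * y) - 1) / b * a = a / b * expR (b * y) + (1 - a / b) - 1.
  by field; rewrite gt_eqF.
lra.
Qed.

Lemma expR_slope_cvg y : (expR (a * y) - 1) / a @[a --> 0^'+] --> y.
Proof.
apply: (@squeeze_cvgr _ _ _ _ (cst y) (fun a => y * expR (a * y))).
- near=> a; have a0 : 0 < a by [].
  by rewrite expR_slope_ge//= expR_slope_le.
- exact: cvg_cst.
- rewrite (_ : nbhs y = nbhs (y * expR (0 * y))); last first.
    by rewrite mul0r expR0 mulr1.
  apply: cvgM; first exact: cvg_cst.
  apply: continuous_cvg; first exact: continuous_expR.
  by apply: cvgM; [apply: cvg_at_right_filter; exact: cvg_id|exact: cvg_cst].
Unshelve. all: by end_near. Qed.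

End expR_facts.

(** * Integrals with respect to an arbitrary measure *)

Section measure_facts.
Context {d : measure_display} {X : measurableType d} {R : realType}.
Implicit Types mu : {measure set X -> \bar R}.

Lemma integrable_ae_eq mu (f g : X -> \bar R) : measurable_fun setT g ->
  ae_eq mu setT f g -> mu.-integrable setT f -> mu.-integrable setT g.
Proof.
move=> mg fg /integrableP[mf foo]; apply/integrableP; split=> //.
rewrite -(@ae_eq_integral _ _ _ mu setT (abse \o g) (abse \o f))//.
- exact: measurableT_comp.
- exact: measurableT_comp.
- by apply: filterS fg => x /= h /h ->.
Qed.

Lemma Rintegral_eq0_ae mu (f : X -> R) : (forall x, 0 <= f x) ->
  mu.-integrable setT (EFin \o f) -> \int[mu]_x f x = 0 ->
  ae_eq mu setT f (cst 0).
Proof.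
move=> f0 fi; rewrite /Rintegral => h.
have mf := measurable_int _ fi.
have /ae_eq_integral_abs : (\int[mu]_x `|(EFin \o f) x| = 0)%E.
  under eq_integral do rewrite gee0_abs ?lee_fin//.
  by rewrite -(fineK (integrable_fin_num measurableT fi)) h.
move=> /(_ measurableT mf); apply: filterS => x /= + _ => /(_ I).
by case.
Qed.

(** Hoelder's inequality with exponents [1/t] and [1/(1-t)] for the normalised
    functions [expR u] and [expR v], with its equality case: the pointwise gap in
    the convexity inequality is nonnegative, so it vanishes a.e. as soon as its
    integral does, and strict convexity then identifies [u] and [v]. *)
Lemma Rintegral_expR_convex mu (u v : X -> R) t :
  0 < t -> t < 1 -> measurable_fun setT u -> measurable_fun setT v ->
  mu.-integrable setT (fun x => (expR (u x))%:E) ->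
  mu.-integrable setT (fun x => (expR (v x))%:E) ->
  \int[mu]_x expR (u x) = 1 -> \int[mu]_x expR (v x) = 1 ->
  \int[mu]_x expR (t * u x + (1 - t) * v x) <= 1 /\
  (\int[mu]_x expR (t * u x + (1 - t) * v x) = 1 -> ae_eq mu setT u v).
Proof.
move=> t0 t1 mu_ mv iu iv u1 v1.
have t1' : 0 < 1 - t by rewrite subr_gt0.
pose G x := t * expR (u x) + (1 - t) * expR (v x).
pose h x := expR (t * u x + (1 - t) * v x).
have hG x : h x <= G x by rewrite expR_convex// ltW.
have mh : measurable_fun setT h.
  apply: measurableT_comp => //.
  by apply: measurable_funD; apply: measurable_funM.
have iu' : mu.-integrable setT (EFin \o (fun x => t * expR (u x)))
  := integrableZl measurableT t iu.
have iv' : mu.-integrable setT (EFin \o (fun x => (1 - t) * expR (v x)))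
  := integrableZl measurableT (1 - t) iv.
have iG : mu.-integrable setT (EFin \o G) := integrableD measurableT iu' iv'.
have ih : mu.-integrable setT (EFin \o h).
  apply: le_integrable iG => //; first exact/measurable_EFinP.
  move=> x _; rewrite lee_fin !ger0_norm ?expR_ge0//.
  by rewrite (le_trans _ (hG x)) ?expR_ge0.
have G1 : \int[mu]_x G x = 1.
  by rewrite /G RintegralD// !RintegralZl// u1 v1; ring.
split.
  by rewrite -[leRHS]G1; apply: le_Rintegral => // x _; exact: hG.
move=> h1.
have := @Rintegral_eq0_ae mu (fun x => G x - h x).
rewrite RintegralB// G1 h1 subrr.
move=> /(_ _ (integrableB measurableT iG ih) erefl) H.
have {}H := H (fun x => etrans (subr_ge0 _ _) (hG x)).
apply: filterS H => x /= /(_ I) /eqP; rewrite subr_eq0 => /eqP e _.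
by apply: (@expR_convex_eq _ t) => //; rewrite -e.
Qed.

End measure_facts.

(** * Expectations of exponentials *)

Section expectations.
Context {d : measure_display} {X : measurableType d} {R : realType}.
Variable Q : probability X R.
Implicit Types (f g : X -> R) (a b : R).

Lemma L1_measurable g : L1 Q g -> measurable_fun setT g.
Proof. by move=> /measurable_int /measurable_EFinP. Qed.

Lemma L1_cst a : L1 Q (cst a).
Proof. exact: finite_measure_integrable_cst. Qed.

Lemma L1_le f g : measurable_fun setT f -> (forall x, `|f x| <= g x) ->
  L1 Q g -> L1 Q f.
Proof.
move=> mf fg; apply: le_integrable => //; first exact/measurable_EFinP.
by move=> x _; rewrite lee_fin (le_trans (fg x))// ler_norm.
Qed.

Lemma L1D f g : L1 Q f -> L1 Q g -> L1 Q (fun x => f x + g x).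
Proof. exact: (integrableD measurableT). Qed.

Lemma L1Z a f : L1 Q f -> L1 Q (fun x => a * f x).
Proof. exact: (integrableZl measurableT a). Qed.

Lemma expect_cst a : expect Q (cst a) = a.
Proof.
by rewrite /expect Rintegral_cst// [X in fine X](probability_setT Q) mulr1.
Qed.

(** Jensen's inequality, by integrating the tangent of [expR] at [E g]. *)
Lemma jensen_expR g : L1 Q g -> L1 Q (expR \o g) ->
  expR (expect Q g) <= expect Q (expR \o g).
Proof.
move=> ig ie; set m := expect Q g.
pose l x := expR m * g x + expR m * (1 - m).
have il1 : L1 Q (fun x => expR m * g x) by exact: L1Z.
have il : L1 Q l by apply: L1D => //; exact: L1_cst.
have <- : expect Q l = expR m.
  rewrite /expect RintegralD//; last exact: L1_cst.
  rewrite RintegralZl// -/(expect Q g) -/m.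
  by rewrite -/(expect Q (cst (expR m * (1 - m)))) expect_cst; ring.
apply: le_Rintegral => // x _; apply: le_trans (expR_tangent m _).
by rewrite /l; lra.
Qed.

Lemma L1_expR_le g a b : 0 <= a -> a <= b -> measurable_fun setT g ->
  L1 Q (fun x => expR (b * g x)) -> L1 Q (fun x => expR (a * g x)).
Proof.
move=> a0 ab mg ib; apply: (@L1_le _ (fun x => 1 + expR (b * g x))).
- by apply: measurableT_comp => //; exact: measurable_funM.
- move=> x; rewrite ger0_norm ?expR_ge0//.
  have [g0|/ltW g0] := leP (g x) 0.
    by apply: ler_wpDr; rewrite ?expR_ge0// -expR0 ler_expR mulr_ge0_le0.
  by apply: ler_wpDl => //; rewrite ler_expR ler_wpM2r.
- by apply: L1D => //; exact: L1_cst.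
Qed.

(** Dominated convergence: for [0 < a <= b] the difference quotient lies between
    [g] and its value at [b]. *)
Lemma expect_slope_cvg g b : 0 < b -> L1 Q g ->
  L1 Q (fun x => expR (b * g x)) ->
  expect Q (fun x => (expR (a * g x) - 1) / a) @[a --> 0^'+] --> expect Q g.
Proof.
move=> b0 ig ib; have mg := L1_measurable _ ig.
pose D a x := (expR (a * g x) - 1) / a.
have mD a : measurable_fun setT (D a).
  apply: measurable_funM => //; apply: measurable_funB => //.
  by apply: measurableT_comp => //; exact: measurable_funM.
apply/cvg_at_rightP => u [u0 u_cvg].
(* The domination holds only for parameters up to [b], and [u] may exceed [b]
   for finitely many indices. *)
pose w n := Num.min (u n) b.
have w0 n : 0 < w n by rewrite lt_min u0.
have w_cvg : w n @[n --> \oo] --> 0.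
  apply: (squeeze_cvgr _ (cvg_cst 0) u_cvg).
  by apply: nearW => n; rewrite ltW//= ge_min lexx.
suff H : expect Q (D (w n)) @[n --> \oo] --> expect Q g.
  apply: cvg_trans H; apply: near_eq_cvg.
  near=> n; have ub : u n < b by near: n; exact: (cvgr_lt 0).
  by rewrite /w min_l// ltW.
have slope_le n x : `|D (w n) x| <= `|g x| + b^-1 * expR (b * g x).
  have lo := expR_slope_ge _ (g x) (w0 n).
  have wb : w n <= b by rewrite ge_min lexx orbT.
  have hi := expR_slope_homo _ _ (g x) (w0 n) wb.
  have b1 : 0 < b^-1 by rewrite invr_gt0.
  have e0 : 0 <= b^-1 * expR (b * g x) by rewrite mulr_ge0 ?expR_ge0 ?ltW.
  rewrite mulrBl mul1r (mulrC (expR _)) in hi.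
  have gl : - `|g x| <= g x by rewrite lerNl -normrN ler_norm.
  have g0 := normr_ge0 (g x).
  by rewrite ler_norml /D; apply/andP; split; lra.
have mDE n : measurable_fun setT (EFin \o D (w n)) by exact/measurable_EFinP.
have Dg : {ae Q, forall x, setT x ->
    (EFin \o D (w n)) x @[n --> \oo] --> (EFin \o g) x}.
  apply: aeW => x _; apply: cvg_EFin; first exact: nearW.
  by have /cvg_at_rightP := expR_slope_cvg (g x); apply.
have iG : L1 Q (fun x => `|g x| + b^-1 * expR (b * g x)).
  by apply: L1D; [exact: integrable_abse ig|exact: L1Z].
have le_ae : {ae Q, forall x n, setT x ->
    (`|(EFin \o D (w n)) x| <= (`|g x| + b^-1 * expR (b * g x))%:E)%E}.
  by apply: aeW => x n _; rewrite lee_fin.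
have [_ _ H] :=
  dominated_convergence measurableT mDE (measurable_int _ ig) Dg iG le_ae.
apply: fine_cvg.
rewrite fineK; first exact: H.
exact: integrable_fin_num.
Unshelve. all: by end_near. Qed.

(** The cumulant generating function of [g] has right derivative [E g] at 0:
    squeeze between Jensen's inequality and [ln x <= x - 1]. *)
Lemma ln_expect_expR_cvg g b : 0 < b -> L1 Q g ->
  L1 Q (fun x => expR (b * g x)) ->
  a^-1 * ln (expect Q (fun x => expR (a * g x))) @[a --> 0^'+] --> expect Q g.
Proof.
move=> b0 ig ib; have mg := L1_measurable _ ig.
apply: (@squeeze_cvgr _ _ _ _ (cst (expect Q g))
  (fun a => expect Q (fun x => (expR (a * g x) - 1) / a))); last first.
- exact: expect_slope_cvg ib.
- exact: cvg_cst.
near=> a.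
have a0 : 0 < a by [].
have ab : a <= b by near: a; exact: nbhs_right_le.
have iag : L1 Q (fun x => a * g x) by exact: L1Z.
have ia : L1 Q (fun x => expR (a * g x)).
  by apply: (L1_expR_le _ a b) => //; exact: ltW.
have J : expR (a * expect Q g) <= expect Q (fun x => expR (a * g x)).
  have <- : expect Q (fun x => a * g x) = a * expect Q g by exact: RintegralZl.
  exact: jensen_expR.
have M0 := lt_le_trans (expR_gt0 _) J.
have -> : expect Q (fun x => (expR (a * g x) - 1) / a)
    = a^-1 * (expect Q (fun x => expR (a * g x)) - 1).
  rewrite /expect; under eq_Rintegral do rewrite mulrC.
  rewrite RintegralZl//; last first.
    by apply: (@L1D _ (cst (-1))) => //; exact: L1_cst.
  rewrite RintegralB//; last exact: L1_cst.
  by rewrite -/(expect Q (cst 1)) expect_cst.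
rewrite /= ler_pM2l ?invr_gt0//.
rewrite -ler_pdivrMl ?invr_gt0// invrK.
rewrite -ler_expR lnK// J /=.
have := @le_ln1Dx R (expect Q (fun x => expR (a * g x)) - 1).
by rewrite addrCA subrr addr0; apply; lra.
Unshelve. all: by end_near. Qed.

End expectations.

(** * Expectations of powers *)

Section powers.
Context {d : measure_display} {X : measurableType d} {R : realType}.
Variables (Q : probability X R) (p : X -> R) (b : R).
Hypotheses (mp : measurable_fun setT p) (p_gt0 : {ae Q, forall x, 0 < p x}).

Lemma powR_ae_expR a :
  ae_eq Q setT (fun x => (p x `^ a)%:E) (fun x => (expR (a * ln (p x)))%:E).
Proof. by apply: filterS p_gt0 => x px _; rewrite /powR gt_eqF. Qed.

Lemma measurable_ln_comp : measurable_fun setT (fun x => ln (p x)).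
Proof. by apply: measurableT_comp. Qed.

Lemma measurable_expR_ln a :
  measurable_fun setT (fun x => (expR (a * ln (p x)))%:E).
Proof.
apply/measurable_EFinP; apply: measurableT_comp => //.
by apply: measurable_funM => //; exact: measurable_ln_comp.
Qed.

Lemma measurable_powR_comp a : measurable_fun setT (fun x => (p x `^ a)%:E).
Proof.
by apply/measurable_EFinP; apply: (measurableT_comp (measurable_powR _)).
Qed.

Lemma L1_powRE a :
  L1 Q (fun x => p x `^ a) <-> L1 Q (fun x => expR (a * ln (p x))).
Proof.
split; apply: integrable_ae_eq.
- exact: measurable_expR_ln.
- exact: powR_ae_expR.
- exact: measurable_powR_comp.
- exact/ae_eq_sym/powR_ae_expR.
Qed.

Lemma expect_powRE a :
  expect Q (fun x => p x `^ a) = expect Q (fun x => expR (a * ln (p x))).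
Proof.
rewrite /expect /Rintegral; congr fine; apply: ae_eq_integral => //.
- exact: measurable_powR_comp.
- exact: measurable_expR_ln.
- exact: powR_ae_expR.
Qed.

Hypotheses (b_gt0 : 0 < b) (L1_pb : L1 Q (fun x => p x `^ b))
  (L1_lnp : L1 Q (fun x => ln (p x))).

(** Positivity is read off Jensen's bound [expR (a * E (ln p))]. *)
Lemma powR_moment a : 0 < a -> a <= b ->
  L1 Q (fun x => p x `^ a) /\ 0 < expect Q (fun x => p x `^ a).
Proof.
move=> a0 ab; have ia : L1 Q (fun x => expR (a * ln (p x))).
  apply: (L1_expR_le _ (fun x => ln (p x)) a b) => //; first exact: ltW.
    exact: measurable_ln_comp.
  by apply/L1_powRE.
split; first exact/L1_powRE.
rewrite expect_powRE.
by apply: lt_le_trans (jensen_expR _ _ (L1Z _ a _ L1_lnp) ia); exact: expR_gt0.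
Qed.

Lemma ln_expect_powR_cvg :
  a^-1 * ln (expect Q (fun x => p x `^ a)) @[a --> 0^'+] -->
  expect Q (fun x => ln (p x)).
Proof.
under eq_fun do rewrite expect_powRE//.
apply: (ln_expect_expR_cvg _ (fun x => ln (p x)) b) => //.
exact/L1_powRE.
Qed.

End powers.

(** * Densities *)

Section densities.
Context {d : measure_display} {X : measurableType d} {R : realType}.
Variable lambda : {sigma_finite_measure set X -> \bar R}.

Lemma ae_dominated (Q : probability X R) (p : X -> R) : Q `<< lambda ->
  {ae lambda, forall x, 0 < p x} -> {ae Q, forall x, 0 < p x}.
Proof.
move=> Ql p0.
have /(null_dominates_ae_eq measurableT Ql) :
    ae_eq lambda setT (fun x => 0 < p x) (cst true).
  by apply: filterS p0 => x px _.
by apply: filterS => x /(_ I).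
Qed.

Section one_density.
Import Radon_Nikodym_SigmaFinite.
Variables (Q : probability X R) (q : X -> R).
Hypotheses (dQ : is_density lambda Q q) (Ql : Q `<< lambda).

(** A density coincides a.e. with the Radon-Nikodym derivative, for which the
    change of variables is known. *)
Lemma integral_density (h : X -> R) :
  measurable_fun setT h -> (forall x, 0 <= h x) ->
  (\int[Q]_x (h x)%:E = \int[lambda]_x (h x * q x)%:E)%E.
Proof.
move: dQ => [mq q0 qE] mh h0.
have mhE : measurable_fun setT (EFin \o h) by exact/measurable_EFinP.
have mqE : measurable_fun setT (EFin \o q) by exact/measurable_EFinP.
have mf := measurable_int _ (f_integrable Ql).
rewrite -(@change_of_variables _ _ _ Q lambda Ql (EFin \o h))//.
apply: ge0_ae_eq_integral => //.
- exact: emeasurable_funM.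
- exact/measurable_EFinP/measurable_funM.
- by move=> x _; rewrite mule_ge0 ?lee_fin ?f_ge0.
- by move=> x _; rewrite lee_fin mulr_ge0.
have : ae_eq lambda setT (f Q lambda) (EFin \o q).
  apply: integral_ae_eq => //; first exact: f_integrable.
  by move=> E _ mE; rewrite -[RHS](qE _ mE); exact/esym/f_integral.
by apply: filterS => x /= + _ => /(_ I) ->; rewrite EFinM.
Qed.

Hypothesis q_gt0 : {ae lambda, forall x, 0 < q x}.

Lemma integral_expR_density (u : X -> R) : measurable_fun setT u ->
  (\int[Q]_x (expR (u x))%:E = \int[lambda]_x (expR (u x + ln (q x)))%:E)%E.
Proof.
move=> mu_; have mq : measurable_fun setT q by case: dQ.
have meu : measurable_fun setT (expR \o u) by exact: measurableT_comp.
rewrite (integral_density (expR \o u))//; last by move=> x; exact: expR_ge0.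
apply: ae_eq_integral => //.
- by apply/measurable_EFinP/measurable_funM.
- apply/measurable_EFinP; apply: measurableT_comp => //.
  by apply: measurable_funD => //; exact: measurable_ln_comp.
- by apply: filterS q_gt0 => x qx _; rewrite expRD lnK.
Qed.

Lemma Rintegral_expR_density (u : X -> R) : measurable_fun setT u ->
  \int[lambda]_x expR (u x + ln (q x)) = expect Q (fun x => expR (u x)).
Proof. by move=> mu_; rewrite /expect /Rintegral integral_expR_density. Qed.

Lemma integrable_expR_density (u : X -> R) : L1 Q (fun x => expR (u x)) ->
  measurable_fun setT u ->
  lambda.-integrable setT (fun x => (expR (u x + ln (q x)))%:E).
Proof.
move=> /integrableP[_ fin] mu_; apply/integrableP; split.
  apply/measurable_EFinP; apply: measurableT_comp => //.
  by apply: measurable_funD => //; apply: measurable_ln_comp; case: dQ.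
under eq_integral do rewrite gee0_abs ?lee_fin ?expR_ge0//.
rewrite -integral_expR_density//.
by under eq_integral do rewrite -[(expR _)%:E]gee0_abs ?lee_fin ?expR_ge0//.
Qed.

(** The integral of [q^(1+a)] for the dominating measure is [Q.q^a], so that
    [q^(1+a) / Q.q^a] is a probability density. *)
Lemma normalised_density_power (a : R) :
  L1 Q (fun x => expR (a * ln (q x))) ->
  0 < expect Q (fun x => expR (a * ln (q x))) ->
  let u x := (1 + a) * ln (q x)
    - ln (expect Q (fun x => expR (a * ln (q x)))) in
  [/\ measurable_fun setT u,
      lambda.-integrable setT (fun x => (expR (u x))%:E) &
      \int[lambda]_x expR (u x) = 1].
Proof.
move=> iQ C0; set C := expect _ _ => u.
have mlq : measurable_fun setT (fun x => ln (q x)).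
  by apply: measurable_ln_comp; case: dQ.
have malq : measurable_fun setT (fun x => a * ln (q x)).
  exact: measurable_funM.
have uE x : expR (u x) = C^-1 * expR (a * ln (q x) + ln (q x)).
  by rewrite /u expRD expRN lnK// mulrC; congr (_ * expR _); ring.
have ie := integrable_expR_density _ iQ malq.
split.
- by apply: measurable_funB => //; exact: measurable_funM.
- by under eq_fun do rewrite uE; exact: (integrableZl measurableT C^-1 ie).
- under eq_Rintegral do rewrite uE.
  by rewrite RintegralZl// Rintegral_expR_density// mulVf// gt_eqF.
Qed.

End one_density.

Section two_densities.
Variables (P Q : probability X R) (p q : X -> R).
Hypotheses (dP : is_density lambda P p) (dQ : is_density lambda Q q)
  (Pl : P `<< lambda) (Ql : Q `<< lambda)
  (p_gt0 : {ae lambda, forall x, 0 < p x})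
  (q_gt0 : {ae lambda, forall x, 0 < q x}).

Let mp : measurable_fun setT p. Proof. by case: dP. Qed.
Let mq : measurable_fun setT q. Proof. by case: dQ. Qed.
Let mlp := measurable_ln_comp p mp.
Let mlq := measurable_ln_comp q mq.

Lemma ae_eq_ln_same_probability :
  ae_eq lambda setT (fun x => ln (p x)) (fun x => ln (q x)) ->
  same_probability P Q.
Proof.
move=> e A mA; case: dP dQ => [_ _ ->//] [_ _ ->//].
apply: ae_eq_integral => //.
- exact/measurable_funTS/measurable_EFinP.
- exact/measurable_funTS/measurable_EFinP.
- near=> x => _; congr EFin; apply: ln_inj.
  + by rewrite posrE; near: x.
  + by rewrite posrE; near: x.
  + by have : setT x by []; near: x.
Unshelve. all: by end_near. Qed.

(** Proportional probability densities are equal, by comparing total masses. *)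
Lemma ae_eq_ln_density_shift k :
  ae_eq lambda setT (fun x => ln (p x)) (fun x => k + ln (q x)) -> k = 0.
Proof.
move=> e.
have mass S s (dS : is_density lambda S s) (Sl : S `<< lambda)
    (s0 : {ae lambda, forall x, 0 < s x}) c :
    \int[lambda]_x expR (c + ln (s x)) = expR c.
  rewrite -(expect_cst S (expR c)).
  by apply: (Rintegral_expR_density S s dS Sl s0 (cst c)).
apply: expR_inj; rewrite -(mass Q q dQ Ql q_gt0) -(mass P p dP Pl p_gt0).
congr fine; apply: ae_eq_integral => //.
- by apply/measurable_EFinP; apply: measurableT_comp => //; exact: measurable_funD.
- by apply/measurable_EFinP; apply: measurableT_comp => //; exact: measurable_funD.
- by apply: filterS e => x /= h /h ->; rewrite add0r.
Qed.

(** Finiteness of the entropy term. The bound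
    [|ln q| <= |ln p| + p / q + q^b / b] follows from [1 + y <= expR y] at
    [y = ln p - ln q] and at [y = b * ln q], and the [Q]-integral of [p / q] is
    the total mass of [P]. *)
Lemma L1_ln_density b : 0 < b -> L1 Q (fun x => q x `^ b) ->
  L1 Q (fun x => ln (p x)) -> L1 Q (fun x => ln (q x)).
Proof.
move=> b0 iq ip.
have ir : L1 Q (fun x => expR (ln (p x) - ln (q x))).
  apply/integrableP; split.
    by apply/measurable_EFinP; apply: measurableT_comp => //; exact: measurable_funB.
  under eq_integral do rewrite gee0_abs ?lee_fin ?expR_ge0//.
  rewrite (integral_expR_density Q q dQ Ql q_gt0)//; last exact: measurable_funB.
  under eq_integral do rewrite subrK -[ln _]add0r.
  rewrite -(@integral_expR_density P p dP Pl p_gt0 (cst 0))//.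
  have : L1 P (cst (expR 0)) by exact: L1_cst.
  move=> /integrableP[_]; apply: le_lt_trans.
  by under [leRHS]eq_integral do rewrite gee0_abs ?lee_fin ?expR_ge0//.
(* the quotient [p / q] is written [expR (ln p - ln q)] so that the bound holds
   everywhere, also where a density vanishes and [ln] takes its default value *)
apply: (@L1_le _ _ _ _ _
  (fun x => `|ln (p x)| + expR (ln (p x) - ln (q x)) + b^-1 * q x `^ b)) => //.
- move=> x; have h0 := normr_ge0 (ln (p x)).
  have h1 := expR_ge1Dx (ln (p x) - ln (q x)).
  have h2 : - `|ln (p x)| <= ln (p x) by rewrite lerNl -normrN ler_norm.
  have b1 : 0 < b^-1 by rewrite invr_gt0.
  have h3 : 0 <= b^-1 * q x `^ b by rewrite mulr_ge0 ?powR_ge0// ltW.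
  have h4 : ln (q x) <= b^-1 * q x `^ b.
    have [qx|qx] := leP (q x) 0; first by rewrite ln0.
    rewrite ler_pdivlMl// /powR gt_eqF//.
    by have := expR_ge1Dx (b * ln (q x)); lra.
  have h5 := expR_ge0 (ln (p x) - ln (q x)).
  by rewrite ler_norml; apply/andP; split; lra.
- apply: L1D; last exact: L1Z.
  by apply: L1D => //; exact: integrable_abse ip.
Qed.

Variable a : R.
Hypotheses (a0 : 0 < a)
  (iP : L1 P (fun x => expR (a * ln (p x))))
  (iQ : L1 Q (fun x => expR (a * ln (q x))))
  (iM : L1 Q (fun x => expR (a * ln (p x))))
  (A0 : 0 < expect P (fun x => expR (a * ln (p x))))
  (B0 : 0 < expect Q (fun x => expR (a * ln (q x))))
  (M0 : 0 < expect Q (fun x => expR (a * ln (p x)))).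
Let lA := ln (expect P (fun x => expR (a * ln (p x)))).
Let lB := ln (expect Q (fun x => expR (a * ln (q x)))).
Let lM := ln (expect Q (fun x => expR (a * ln (p x)))).

(** The Renyi pseudodistance is [a^-1] times the logarithmic gap in Hoelder's
    inequality for the normalised powers of [p] and [q] with weight
    [t = a / (1 + a)]. *)
Lemma renyi_gap :
  0 <= (1 + a)^-1 * lA + (a * (1 + a))^-1 * lB - a^-1 * lM /\
  ((1 + a)^-1 * lA + (a * (1 + a))^-1 * lB - a^-1 * lM = 0 ->
   same_probability P Q).
Proof.
have a1 : 0 < 1 + a by rewrite addr_gt0.
have [mu_ iu u1] := normalised_density_power P p dP Pl p_gt0 a iP A0.
have [mv iv v1] := normalised_density_power Q q dQ Ql q_gt0 a iQ B0.
rewrite -/lA -/lB in mu_ iu u1 mv iv v1.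
pose t := a / (1 + a); pose c := t * lA + (1 - t) * lB.
have t0 : 0 < t by rewrite divr_gt0.
have t1 : t < 1 by rewrite ltr_pdivrMr// mul1r ltrDr.
have [] := Rintegral_expR_convex lambda _ _ t t0 t1 mu_ mv iu iv u1 v1.
have tE x : expR (t * ((1 + a) * ln (p x) - lA)
    + (1 - t) * ((1 + a) * ln (q x) - lB)) = expR (a * ln (p x) - c + ln (q x)).
  by congr expR; rewrite /c /t; field; rewrite gt_eqF.
have map_ : measurable_fun setT (fun x => a * ln (p x) - c).
  by apply: measurable_funB => //; exact: measurable_funM.
have -> : \int[lambda]_x expR (t * ((1 + a) * ln (p x) - lA)
    + (1 - t) * ((1 + a) * ln (q x) - lB)) = expR (lM - c).
  under eq_Rintegral do rewrite tE.
  rewrite (Rintegral_expR_density Q q dQ Ql q_gt0 _ map_).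
  rewrite expRD /lM lnK// mulrC /expect.
  under eq_Rintegral do rewrite expRD mulrC.
  exact: RintegralZl.
have -> : (1 + a)^-1 * lA + (a * (1 + a))^-1 * lB - a^-1 * lM = a^-1 * (c - lM).
  by rewrite /c /t; field; rewrite !gt_eqF.
rewrite -[X in _ <= X -> _]expR0 ler_expR subr_le0 => cM eq_case; split.
  by rewrite mulr_ge0 ?invr_ge0 ?subr_ge0// ltW.
move=> /eqP; rewrite mulf_eq0 invr_eq0 gt_eqF//= subr_eq0 => /eqP cE.
have e : ae_eq lambda setT (fun x => ln (p x))
    (fun x => (lA - lB) / (1 + a) + ln (q x)).
  have := eq_case; rewrite cE subrr expR0 => /(_ erefl).
  apply: filterS => x /= h /h uv.
  apply: (@mulfI _ (1 + a)); first by rewrite gt_eqF.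
  by rewrite -[LHS](subrK lA) uv; field; rewrite gt_eqF.
apply: ae_eq_ln_same_probability.
have k0 := ae_eq_ln_density_shift _ e.
by apply: filterS e => x /= h /h ->; rewrite k0 add0r.
Qed.

End two_densities.
End densities.

(** * Renyi pseudodistances *)

Section renyi.
Context {d : measure_display} {X : measurableType d} {R : realType}.
Variable dens : probability X R -> X -> R.

Lemma renyi_xx (a : R) (P : probability X R) : 0 < a -> renyi dens a P P = 0.
Proof.
by move=> a0; rewrite /renyi; field; rewrite !gt_eqF ?addr_gt0.
Qed.

(** The first term of [renyi] is [a / (1 + a)] times a convergent quantity, hence
    tends to 0; the factor [(1 + a)^-1] of the second one tends to 1. *)
Lemma renyi_cvg (P Q : probability X R) (c : R) :
  a^-1 * ln (expect P (fun x => dens P x `^ a)) @[a --> 0^'+] --> c ->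
  a^-1 * ln (expect Q (fun x => dens Q x `^ a)) @[a --> 0^'+] -->
    expect Q (fun x => ln (dens Q x)) ->
  a^-1 * ln (expect Q (fun x => dens P x `^ a)) @[a --> 0^'+] -->
    expect Q (fun x => ln (dens P x)) ->
  renyi dens a P Q @[a --> 0^'+] --> renyi0 dens P Q.
Proof.
move=> cP cQ cPQ.
have a_cvg : (a : R) @[a --> 0^'+] --> (0 : R).
  by apply: cvg_at_right_filter; exact: cvg_id.
have inv_cvg : (1 + a : R)^-1 @[a --> 0^'+] --> (1 : R).
  have one_cvg : (1 + a : R) @[a --> 0^'+] --> (1 + 0 : R).
    by apply: (cvgD (cvg_cst _) a_cvg).
  have n0 : 1 + 0 != 0 :> R by rewrite addr0 oner_neq0.
  by have := cvgV n0 one_cvg; rewrite addr0 invr1; exact.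
have -> : renyi0 dens P Q = 0 * 1 * c + 1 * expect Q (fun x => ln (dens Q x))
    - expect Q (fun x => ln (dens P x)) by rewrite /renyi0; ring.
have split_factor (a x y z : R) : 0 < a ->
    (1 + a)^-1 * x + (a * (1 + a))^-1 * y - a^-1 * z
    = a * (1 + a)^-1 * (a^-1 * x) + (1 + a)^-1 * (a^-1 * y) - a^-1 * z.
  by move=> a0; field; rewrite !gt_eqF ?addr_gt0.
apply: cvg_trans
  (cvgB (cvgD (cvgM (cvgM a_cvg inv_cvg) cP) (cvgM inv_cvg cQ)) cPQ).
apply: near_eq_cvg.
near=> a; have a0 : 0 < a by [].
exact/esym/split_factor.
Unshelve. all: by end_near. Qed.

End renyi.

Theorem theorem3p3p1 (disp : measure_display) (X : measurableType disp)
  (R : realType) (lambda : {sigma_finite_measure set X -> \bar R})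
  (k : nat) (Theta : set 'rV[R]_k)
  (P_ : 'rV[R]_k -> probability X R) (P0 : probability X R)
  (dens : probability X R -> X -> R)
  (calP : set (probability X R)) (calPplus : set (probability X R))
  (calPE : calP = [set P_ theta | theta in Theta])
  (calPplusE : calPplus = calP `|` [set P0])
  (identifiable : forall theta theta', Theta theta -> Theta theta' ->
     theta <> theta' -> ~ same_probability (P_ theta) (P_ theta'))
  (P0_notin : forall P, calP P -> ~ same_probability P0 P)
  (equivalent : forall P Q, calPplus P -> calPplus Q -> P `<< Q)
  (dominated : forall Q, calPplus Q -> Q `<< lambda)
  (densP : forall Q, calPplus Q -> is_density lambda Q (dens Q))
  (dens_gt0 : forall Q, calPplus Q -> {ae lambda, forall x, 0 < dens Q x})
  (beta : R) (beta_gt0 : 0 < beta)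
  (integrability : forall P Q, calP P -> calPplus Q ->
     [/\ L1 Q (fun x => dens P x `^ beta),
         L1 Q (fun x => dens Q x `^ beta) &
         L1 Q (fun x => ln (dens P x))]) :
  (forall alpha : R, 0 < alpha -> alpha < beta ->
     [/\ (forall P Q, calP P -> calPplus Q -> renyi_defined dens alpha P Q),
         pseudodistance Theta P_ (renyi dens alpha) &
         forall P Q, calP P -> calPplus Q ->
           renyi dens alpha P Q
           = renyi_const dens alpha P + renyi_self dens alpha Q
             - alpha^-1 * ln (expect Q (fun x => dens P x `^ alpha))])
  /\ (forall P Q, calP P -> calPplus Q ->
        renyi0_defined dens P Q
        /\ renyi dens alpha P Q @[alpha --> 0^'+] --> renyi0 dens P Q).
Proof.
have sub P : calP P -> calPplus P by rewrite calPplusE; left.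
have mdens Q : calPplus Q -> measurable_fun setT (dens Q) by move=> /densP[].
have ae_gt0 P Q : calPplus P -> calPplus Q -> {ae Q, forall x, 0 < dens P x}.
  by move=> hP hQ; apply: (ae_dominated lambda); [exact: dominated|exact: dens_gt0].
(* for [Q] in the model this is a hypothesis; the case at stake is [Q = P0] *)
have L1_self P Q : calP P -> calPplus Q -> L1 Q (fun x => ln (dens Q x)).
  move=> hP hQ; have [_ iQ ilP] := integrability P Q hP hQ; have hP' := sub P hP.
  by apply: (L1_ln_density lambda P Q (dens P) (dens Q) (densP P hP') (densP Q hQ)
    (dominated P hP') (dominated Q hQ) (dens_gt0 P hP') (dens_gt0 Q hQ) beta).
have moment P Q a : calP P -> calPplus Q -> 0 < a -> a <= beta ->
    renyi_defined dens a P Q.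
  move=> hP hQ a0 ab; have hP' := sub P hP.
  have [iPP _ lPP] := integrability P P hP hP'.
  have [iPQ iQQ lPQ] := integrability P Q hP hQ.
  have lQQ := L1_self P Q hP hQ.
  by split; apply: (powR_moment _ _ beta) => //; auto.
split=> [a a0 ab|P Q hP hQ].
  split=> [P Q hP hQ||//]; first exact: moment (ltW ab).
  move=> th th' hth hth'.
  have hP : calP (P_ th) by rewrite calPE; exists th.
  have hQ : calP (P_ th') by rewrite calPE; exists th'.
  have hP' := sub _ hP; have hQ' := sub _ hQ.
  have [[iP A0] [iQ B0] [iM M0]] := moment _ _ a hP hQ' a0 (ltW ab).
  have := renyi_gap lambda (P_ th) (P_ th') _ _ (densP _ hP') (densP _ hQ')
    (dominated _ hP') (dominated _ hQ') (dens_gt0 _ hP') (dens_gt0 _ hQ') a a0.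
  rewrite -!expect_powRE; auto.
  rewrite -!L1_powRE; auto.
  move=> /(_ iP iQ iM A0 B0 M0)[R0 Req]; split=> //; split=> [/Req same|->].
    by apply: contrapT => /(identifiable _ _ hth hth').
  exact: renyi_xx.
have hP' := sub P hP.
have [iPP _ lPP] := integrability P P hP hP'.
have [iPQ iQQ lPQ] := integrability P Q hP hQ.
have lQQ := L1_self P Q hP hQ.
split; first by split.
by apply: renyi_cvg; apply: (ln_expect_powR_cvg _ _ beta); auto.
Qed.
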